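(* Let $(M,\mathfrak{p})$ be an oriented projective surface and let $g$ be a Riemannian metric on $M$. Then $\mathfrak{p}$ is metrisable by $g$ (that is, the Levi-Civita connection of $g$ belongs to $\mathfrak{p}$) if and only if $[g] : M \to (Z,J_{\mathfrak{p}})$ is a holomorphic curve and $[g] : M \to (Z,\mathfrak{J}_{\mathfrak{p},dA_g})$ is a pseudo-holomorphic curve, where $dA_g$ denotes the area form of $g$.
   Context: Everything is smooth. A projective structure $\mathfrak{p}$ on a surface $M$ is an equivalence class of torsion-free connections on $TM$, where two such connections are equivalent if they have the same geodesics up to parametrisation. An oriented projective surface $(M,\mathfrak{p})$ is an oriented surface $M$ with a projective structure $\mathfrak{p}$. For every volume form $\sigma$ on $M$ there is a unique connection ${}^{\sigma}\nabla\in\mathfrak{p}$ preserving $\sigma$. The bundle $Z$. Let $M$ be an oriented surface. $\pi : Z\to M$ is the bundle whose fibre at $x\in M$ consists of the orientation compatible linear complex structures on $T_xM$. Let $\upsilon : F\to M$ be the oriented frame bundle, whose fibre at $x$ consists of the orientation preserving linear isomorphisms $u:\mathbb{R}^2\to T_xM$; it is a principal right $\mathrm{GL}^+(2,\mathbb{R})$-bundle via $R_a(u)=u\circ a$. Let $\mathrm{GL}(1,\mathbb{C})\subset \mathrm{GL}^+(2,\mathbb{R})$ be the subgroup of matrices commuting with the standard linear complex structure $J_0$ on $\mathbb{R}^2$ (counterclockwise rotation by $\pi/2$). Then $Z=F/\mathrm{GL}(1,\mathbb{C})$ (the class of $u$ corresponds to $u\circ J_0\circ u^{-1}$), with projection $\nu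 : F\to Z$. Let $(\omega^1,\omega^2)$ be the tautological $\mathbb{R}^2$-valued $1$-form on $F$, $\omega_u=u^{-1}\circ \upsilon'_u$, and also write $\omega=\omega^1+\mathrm{i}\omega^2$. The almost complex structures. For a torsion-free connection $\nabla$ on $TM$ with connection form $\theta=(\theta^i_j)$ on $F$ (so $d\omega^i=-\theta^i_j\wedge\omega^j$), set $\zeta=(\theta^1_1-\theta^2_2)+\mathrm{i}(\theta^1_2+\theta^2_1)$. Then $\nabla$ determines a unique pair $(J,\mathfrak{J})$ of almost complex structures on $Z$ such that the $(1,0)$-forms of $J$ pull back along $\nu$ to linear combinations of $\omega,\zeta$, and the $(1,0)$-forms of $\mathfrak{J}$ pull back to linear combinations of $\omega,\overline{\zeta}$. The structure $J$ is integrable and depends only on the projective equivalence class $\mathfrak{p}$ of $\nabla$; it is denoted $J_{\mathfrak{p}}$. For a volume form $\sigma$, $\mathfrak{J}_{\mathfrak{p},\sigma}$ denotes the almost complex structure $\mathfrak{J}$ defined by ${}^{\sigma}\nabla\in\mathfrak{p}$. Conformal structures as sections. The conformal structure $[g]$ of a Riemannian metric $g$ on $M$ is regarded as the section $[g]:M\to Z$ assigning to $x$ the complex structure on $T_xM$ given by counterclockwise rotation by $\pi/2$ with respect to $g$. (Pseudo-)holomorphic curves. For an almost complex structure $\mathcal{J}$ on $Z$, $[g]:M\to(Z,\mathcal{J})$ is called a (pseudo-)holomorphic curve if the image $\Sigma=[g](M)\subset Z$ can be equipped with a complex structure $j$ such that the inclusion $\iota:\Sigma\to Z$ satisfies $\mathcal{J}\circ\iota'=\iota'\circ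 j$. *)

(* Defs.v *)
From HB Require Import structures.
From mathcomp Require Import all_boot all_order all_algebra.
From mathcomp Require Import all_classical all_reals all_analysis.
From mathcomp Require Import complex.
From mathcomp Require Import ring lra.

Set Implicit Arguments.
Unset Strict Implicit.
Unset Printing Implicit Defensive.

Import Order.TTheory GRing.Theory Num.Theory.
Import numFieldNormedType.Exports.

Local Open Scope classical_set_scope.
Local Open Scope ring_scope.
Local Open Scope complex_scope.

Section Smooth.
Context {R : realType}.

Fixpoint Ck {V W : normedModType R} (n : nat) (U : set V) (f : V -> W) : Prop :=
  match n with
  | 0 => forall x, U x -> {for x, continuous f}
  | n'.+1 => (forall x, U x -> differentiable f x) /\
             (forall v, Ck n' U (fun x => 'D_v f x))
  end.

(** Meant for open [U] in a finite-dimensional [V]. *)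
Definition smooth {V W : normedModType R} (U : set V) (f : V -> W) : Prop :=
  forall n, Ck n U f.

(** An atlas modelled on [E] whose charts are partial maps on [T].  The
    manifold it describes is the union of the [dom k], which may be a proper
    subset of [T]: this allows for bundles whose points are cut out of an
    ambient type.  All axioms are kept separate (see [smooth_manifold]). *)
Record charts (E : normedModType R) (T : Type) := Charts {
  idx : Type;
  dom : idx -> set T;
  phi : idx -> T -> E;
  psi : idx -> E -> T }.

Definition cod E T (X : charts E T) (k : idx X) : set E :=
  @phi E T X k @` @dom E T X k.

Definition trans E T (X : charts E T) (k l : idx X) : E -> E :=
  @phi E T X l \o @psi E T X k.

Definition overlap E T (X : charts E T) (k l : idx X) : set E :=
  @phi E T X k @` (@dom E T X k `&` @dom E T X l).

(** The expression of [f] in the charts [k] and [l]. *)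
Definition local_rep E T (X : charts E T) E' T' (Y : charts E' T')
    (f : T -> T') (k : idx X) (l : idx Y) : E -> E' :=
  @phi E' T' Y l \o f \o @psi E T X k.

Definition smooth_manifold E (T : topologicalType) (X : charts E T) : Prop :=
  [/\ hausdorff_space T, @second_countable T,
      (forall x, exists k, @dom E T X k x) &
      [/\ forall k, open (@dom E T X k),
      forall k, open (@cod E T X k),
      forall k x, @dom E T X k x ->
        psi k (phi k x) = x /\ {for x, continuous (@phi E T X k)},
      forall k, {in @cod E T X k, continuous (@psi E T X k)} &
      forall k l, smooth (overlap k l) (@trans E T X k l)]].

(** An almost complex structure, as a field of endomorphisms of the tangent
    spaces: [acs k e] is its value at the point with coordinates [e] in the
    chart [k], the tangent space there being identified with [E]. *)
Record almost_complex E T (X : charts E T) := AlmostComplex {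
  acs :> idx X -> E -> E -> E;
  acs_linear : forall k e, cod k e -> linear (acs k e);
  acs_square : forall k e v, cod k e -> acs k e (acs k e v) = - v;
  acs_compat : forall k l e v, overlap k l e ->
    acs l (trans k l e) ('d (@trans E T X k l) e v)
    = 'd (@trans E T X k l) e (acs k e v);
  acs_smooth : forall k v, smooth (cod k) (fun e => acs k e v) }.

End Smooth.

Section Surface.
Context {R : realType}.

Definition jac (f : 'cV[R]_2 -> 'cV[R]_2) (p : 'cV[R]_2) : 'M[R]_2 :=
  \matrix_(i, j) ('d f p (delta_mx j 0) : 'cV[R]_2) i 0.

Record oriented_surface := OrientedSurface {
  carrier :> topologicalType;
  atlas : charts 'cV[R]_2 carrier;
  atlas_smooth : smooth_manifold atlas;
  atlas_oriented : forall k l p, overlap k l p ->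
    0 < \det (jac (@trans R _ _ atlas k l) p) }.

Notation index M := (idx (atlas M)).

Section Tensors.
Variable M : oriented_surface.

Definition tr (k l : index M) : 'cV[R]_2 -> 'cV[R]_2 := trans k l.

(** A vector at [x] has components [v k : 'cV_2] with
    [v l = jac_at k l x *m v k]. *)
Definition jac_at (k l : index M) (x : M) : 'M[R]_2 := jac (tr k l) (phi k x).

(** A connection on TM, given by its Christoffel symbols
    [Gamma k p v = (Gamma^i_(m j) v^m)_(i,j)]:
    (nabla_v X) = D_v X + Gamma k p v *m X in the chart [k]. *)
Record connection := Connection {
  Gamma :> index M -> 'cV[R]_2 -> 'cV[R]_2 -> 'M[R]_2;
  Gamma_linear : forall k p, cod k p -> linear (Gamma k p);
  Gamma_smooth : forall k v, smooth (cod k) (fun p => Gamma k p v);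
  Gamma_compat : forall k l p v, overlap k l p ->
    Gamma l (tr k l p) (jac (tr k l) p *m v) *m jac (tr k l) p
    = jac (tr k l) p *m Gamma k p v - 'D_v (jac (tr k l)) p }.

Definition torsion_free (D : connection) : Prop :=
  forall k p, cod k p -> forall v w, D k p v *m w = D k p w *m v.

Definition eq_connection (D D' : connection) : Prop :=
  forall k p, cod k p -> D k p =1 D' k p.

Definition open_interval (I : set R) : Prop :=
  [/\ open I, is_interval I & I !=set0].

Definition smooth_curve (I : set R) (c : R -> M) : Prop :=
  (forall t, I t -> {for t, continuous c}) /\
  forall k : index M, smooth (I `&` c @^-1` dom k) (phi k \o c).

Definition geodesic (D : connection) (I : set R) (c : R -> M) : Prop :=
  smooth_curve I c /\
  forall (k : index M) t, I t -> dom k (c t) ->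
    let x := phi k \o c in
    derive1n 2 x t + D k (x t) (derive1 x t) *m derive1 x t = 0.

Definition reparametrisation (I' I : set R) (s : R -> R) : Prop :=
  [/\ smooth I' s, set_bij I' I s & forall t, I' t -> derive1 s t != 0].

Definition geodesics_included (D D' : connection) : Prop :=
  forall I c, open_interval I -> geodesic D I c ->
  exists I' s, [/\ open_interval I', reparametrisation I' I s &
                   geodesic D' I' (c \o s)].

Definition projectively_equivalent (D D' : connection) : Prop :=
  geodesics_included D D' /\ geodesics_included D' D.

Record projective_structure := ProjectiveStructure {
  pconn : set connection;
  pconnP : exists2 D0, torsion_free D0 &
    pconn = [set D | torsion_free D /\ projectively_equivalent D0 D] }.

Record metric := Metric {
  gmx :> index M -> 'cV[R]_2 -> 'M[R]_2;
  gmx_smooth : forall k, smooth (cod k) (gmx k);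
  gmx_sym : forall k p, cod k p -> (gmx k p)^T = gmx k p;
  gmx_pos : forall k p (v : 'cV[R]_2), cod k p -> v != 0 ->
    0 < (v^T *m gmx k p *m v) 0 0;
  gmx_compat : forall k l p, overlap k l p ->
    gmx k p = (jac (tr k l) p)^T *m gmx l (tr k l p) *m jac (tr k l) p }.

Definition levi_civita (g : metric) (D : connection) : Prop :=
  torsion_free D /\
  forall k p v, cod k p ->
    'D_v (g k) p = (D k p v)^T *m g k p + g k p *m D k p v.

Definition metrisable_by (P : projective_structure) (g : metric) : Prop :=
  exists2 D, pconn P D & levi_civita g D.

(** Volume forms are represented by their (nowhere vanishing) coefficients with
    respect to dx^1 /\ dx^2 in the charts of the oriented atlas. *)
Definition area_form (g : metric) (k : index M) (p : 'cV[R]_2) : R :=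
  Num.sqrt (\det (g k p)).

Definition preserves (D : connection) (sigma : index M -> 'cV[R]_2 -> R) : Prop :=
  forall k p v, cod k p ->
    'D_v (sigma k : 'cV[R]_2 -> R^o) p = \tr (D k p v) * sigma k p.

(** [D] is the connection of [P] preserving [sigma], up to equality of the
    Christoffel symbols on the charts. *)
Definition volume_connection (P : projective_structure)
    (sigma : index M -> 'cV[R]_2 -> R) (D : connection) : Prop :=
  [/\ pconn P D, preserves D sigma &
      forall D', pconn P D' -> preserves D' sigma -> eq_connection D' D].

(** A linear map u : R^2 -> T_x M is represented by its matrices [u k] in the
    charts around [x]; the junk value 0 in the other charts makes the
    representation unique. *)
Definition frame_at (x : M) (u : index M -> 'M[R]_2) : Prop :=
  [/\ forall k, dom k x -> 0 < \det (u k),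
      forall k l, dom k x -> dom l x -> u l = jac_at k l x *m u k &
      forall k, ~ dom k x -> u k = 0].

(** The complex structures of R^2 for which [(v, j v)] is a positive basis. *)
Definition oriented_complex (j : 'M[R]_2) : Prop :=
  j *m j = - 1%:M /\
  forall v : 'cV[R]_2, v != 0 -> 0 < \det (row_mx v (j *m v) : 'M[R]_2).

(** An endomorphism of T_x M is represented in the same way. *)
Definition complex_at (x : M) (j : index M -> 'M[R]_2) : Prop :=
  [/\ forall k, dom k x -> oriented_complex (j k),
      forall k l, dom k x -> dom l x -> j l *m jac_at k l x = jac_at k l x *m j k &
      forall k, ~ dom k x -> j k = 0].

Definition frame_bundle : charts ('cV[R]_2 * 'M[R]_2)%type (M * (index M -> 'M[R]_2)) :=
  {| idx := index M;
     dom k := [set y | dom k y.1 /\ frame_at y.1 y.2];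
     phi k y := (phi k y.1, y.2 k);
     psi k e := let x := psi k e.1 in
       (x, fun l => if x \in dom l then jac_at k l x *m e.2 else 0) |}.

(** An orientation compatible complex structure of R^2 is determined by its
    first column [c], which ranges over the upper half plane [0 < c 1 0]. *)
Definition complex_of_col (c : 'cV[R]_2) : 'M[R]_2 :=
  \matrix_(i, j) if j == 0 then c i 0
                 else if i == 0 then - (1 + c 0 0 ^+ 2) / c 1 0 else - c 0 0.

Definition Zbundle : charts ('cV[R]_2 * 'cV[R]_2)%type (M * (index M -> 'M[R]_2)) :=
  {| idx := index M;
     dom k := [set z | dom k z.1 /\ complex_at z.1 z.2];
     phi k z := (phi k z.1, col 0 (z.2 k));
     psi k e := let x := psi k e.1 in
       (x, fun l => if x \in dom l then
             jac_at k l x *m complex_of_col e.2 *m invmx (jac_at k l x) else 0) |}.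

(** J0 e1 = e2 and J0 e2 = - e1. *)
Definition J0 : 'M[R]_2 :=
  \matrix_(i, j) if (i == 0) && (j == 1) then -1
                 else if (i == 1) && (j == 0) then 1 else 0.

Definition nu (y : M * (index M -> 'M[R]_2)) : M * (index M -> 'M[R]_2) :=
  (y.1, fun k => y.2 k *m J0 *m invmx (y.2 k)).

(** Forms on F: the point with coordinates [e = (p, a)] is the frame with
    matrix [a] at the point with coordinates [p], and the tangent vector
    [v = (w, b)] has projection [w] to TM. *)
Definition tautological (e v : 'cV[R]_2 * 'M[R]_2) : 'cV[R]_2 :=
  invmx e.2 *m v.1.

(** theta = a^-1 (da + Gamma(dx) a), so that d omega = - theta /\ omega for
    torsion-free connections. *)
Definition connection_form (D : connection) (k : index M)
    (e v : 'cV[R]_2 * 'M[R]_2) : 'M[R]_2 :=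
  invmx e.2 *m (v.2 + D k e.1 v.1 *m e.2).

Definition omega (e v : 'cV[R]_2 * 'M[R]_2) : R[i] :=
  let w := tautological e v in w 0 0 +i* w 1 0.

Definition zeta (D : connection) (k : index M) (e v : 'cV[R]_2 * 'M[R]_2) : R[i] :=
  let th := connection_form D k e v in
  (th 0 0 - th 1 1) +i* (th 0 1 + th 1 0).

(** [alpha] is a complex-valued covector of type (1,0) for the endomorphism
    [A] of the tangent space [E]. *)
Definition form10 (E : normedModType R) (A : E -> E) (alpha : E -> R[i]) : Prop :=
  [/\ forall v w, alpha (v + w) = alpha v + alpha w,
      forall (r : R) v, alpha (r *: v) = r%:C * alpha v &
      forall v, alpha (A v) = (0 +i* 1) * alpha v].

(** The (1,0)-forms of [J] pull back along [nu] to combinations of [omega]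
    and [eta]. *)
Definition adapted (eta : index M -> 'cV[R]_2 * 'M[R]_2 -> 'cV[R]_2 * 'M[R]_2 -> R[i])
    (J : almost_complex Zbundle) : Prop :=
  forall (k : index M) e, @cod R _ _ frame_bundle k e ->
  let nuk := @local_rep R _ _ frame_bundle _ _ Zbundle nu k k in
  forall alpha, form10 (J k (nuk e)) alpha ->
  exists c1 c2 : R[i], forall v,
    alpha ('d nuk e v) = c1 * omega e v + c2 * eta k e v.

(** [J] is J_P: the almost complex structure defined by each connection of [P]. *)
Definition is_Jproj (P : projective_structure) (J : almost_complex Zbundle) : Prop :=
  forall D, pconn P D -> adapted (zeta D) J.

Definition is_Jvol (P : projective_structure) (sigma : index M -> 'cV[R]_2 -> R)
    (J : almost_complex Zbundle) : Prop :=
  exists2 D, volume_connection P sigma D &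
             adapted (fun k e v => (zeta D k e v)^*) J.

(** sqrt(det g) g^-1 J0 is the counterclockwise rotation by pi/2 with respect
    to [g], see [rotationP]. *)
Definition rotation (g : 'M[R]_2) : 'M[R]_2 :=
  Num.sqrt (\det g) *: (invmx g *m J0).

Definition conformal_section (g : metric) (x : M) : M * (index M -> 'M[R]_2) :=
  (x, fun k => if x \in dom k then rotation (g k (phi k x)) else 0).

(** The image of a section of Z -> M, with the atlas obtained from that of [M]
    through the section. *)
Definition image_surface (s : M -> M * (index M -> 'M[R]_2)) :
    charts 'cV[R]_2 (M * (index M -> 'M[R]_2)) :=
  {| idx := index M;
     dom k := s @` dom k;
     phi k z := phi k z.1;
     psi k p := s (psi k p) |}.

(** The condition is J o iota' = iota' o j in all charts, iota being the
    inclusion of the image in Z.  On a surface every almost complex structure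
    is integrable, so [j] is a complex structure. *)
Definition holomorphic_curve (J : almost_complex Zbundle)
    (s : M -> M * (index M -> 'M[R]_2)) : Prop :=
  exists j : almost_complex (image_surface s),
  forall (k l : index M) p, @cod R _ _ (image_surface s) k p ->
  @dom R _ _ Zbundle l (@psi R _ _ (image_surface s) k p) ->
  let iota := @local_rep R _ _ (image_surface s) _ _ Zbundle id k l in
  forall v, J l (iota p) ('d iota p v) = 'd iota p (j k p v).

End Tensors.

Lemma rotationP (g : 'M[R]_2) : g^T = g ->
  (forall v : 'cV[R]_2, v != 0 -> 0 < (v^T *m g *m v) 0 0) ->
  [/\ oriented_complex (rotation g), (rotation g)^T *m g *m rotation g = g &
      forall v : 'cV[R]_2, (v^T *m g *m (rotation g *m v)) 0 0 = 0].
Proof.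
move=> gsym gpos.
have s10 : g 1 0 = g 0 1 by rewrite -[in LHS]gsym mxE.
have I2 (i : 'I_2) : i = 0 \/ i = 1.
  by case: i => [[|[|//]] ?]; [left|right]; exact/val_inj.
have sum2 (F : 'I_2 -> R) : \sum_i F i = F 0 + F 1.
  by rewrite big_ord_recr big_ord1; congr (F _ + F _); exact/val_inj.
have l00 : lift (0 : 'I_2) (0 : 'I_1) = 1 by exact/val_inj.
have l10 : lift (1 : 'I_2) (0 : 'I_1) = 0 by exact/val_inj.
have det2 (A : 'M[R]_2) : \det A = A 0 0 * A 1 1 - A 0 1 * A 1 0.
  rewrite (expand_det_row _ 0) sum2 /cofactor !det_mx11 !mxE /= expr0 expr1.
  by rewrite l00 l10 mul1r mulN1r mulrN.
have quad (v w : 'cV[R]_2) : (v^T *m g *m w) 0 0 =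
    (v 0 0 * g 0 0 + v 1 0 * g 0 1) * w 0 0 + (v 0 0 * g 0 1 + v 1 0 * g 1 1) * w 1 0.
  by rewrite !(mxE, sum2) s10.
pose vec (a b : R) : 'cV[R]_2 := \col_i (if i == 0 then a else b).
have vecN0 a b : b != 0 \/ a != 0 -> vec a b != 0.
  move=> ab; apply/eqP => /matrixP e; move: ab (e 0 0) (e 1 0).
  by rewrite !mxE /= => -[] /eqP.
have E0 : 0 < g 0 0.
  have /gpos := vecN0 1 0 (or_intror (oner_neq0 R)).
  by rewrite quad !mxE /=; lra.
have d0 : 0 < g 0 0 * g 1 1 - g 0 1 * g 0 1.
  have /gpos := vecN0 (- g 0 1) (g 0 0) (or_introl (lt0r_neq0 E0)).
  rewrite quad !mxE /= => h.
  rewrite -(pmulr_rgt0 _ E0); move: h; congr (0 < _); ring.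
have detE : \det g = g 0 0 * g 1 1 - g 0 1 * g 0 1 by rewrite det2 s10.
have gu : g \in unitmx by rewrite unitmxE unitfE detE gt_eqF.
set d := g 0 0 * g 1 1 - _ in d0 detE.
pose r := Num.sqrt d.
have r0 : 0 < r by rewrite sqrtr_gt0.
have rN := lt0r_neq0 r0.
have rr : r * r = g 0 0 * g 1 1 - g 0 1 * g 0 1 by rewrite -expr2 sqr_sqrtr ?ltW.
pose j : 'M[R]_2 := \matrix_(i, k)
  ((if i == 0 then (if k == 0 then - g 0 1 else - g 1 1)
          else (if k == 0 then g 0 0 else g 0 1)) / r).
have rotE : rotation g = j.
  rewrite /rotation detE -/r; apply: (can_inj (mulKmx gu)).
  rewrite -scalemxAr mulKVmx //; apply/matrixP => i k.
  rewrite !(mxE, sum2) /=.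
  case: (I2 i) (I2 k) => [] -> [] -> /=; apply: (mulIf rN);
    rewrite ?s10 ?mulrDl !mulrA !divfK //; 
    rewrite ?(mulr0, mulr1, mul0r, mulrN, mulNr, rr); ring.
have G11 : g 1 1 = (r * r + g 0 1 * g 0 1) / g 0 0.
  by rewrite rr; field; exact: lt0r_neq0.
have EN := lt0r_neq0 E0.
rewrite rotE; split.
- split.
    apply/matrixP => i k; rewrite 2!mxE sum2.
    case: (I2 i) (I2 k) => [] -> [] ->;
      rewrite !mxE /= ?G11; field; rewrite ?rN ?EN /= ?andbT //.
  move=> v v0; rewrite det2.
  have -> : (row_mx v (j *m v) : 'M[R]_2) = \matrix_(i, k) (if k == 0 then v i 0 else (j *m v) i 0).
    apply/matrixP => i k; rewrite [RHS]mxE [LHS]mxE; case: splitP => -[[|//] q] /= e;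
      case: (I2 k) e => -> //= _; first by congr (v _ _); exact/val_inj.
    by congr ((j *m v) _ _); exact/val_inj.
  rewrite !(mxE, sum2) /=.
  have := gpos _ v0; rewrite quad => h.
  rewrite -(pmulr_lgt0 _ r0); move: h; congr (0 < _); field.
  by [].
- apply/matrixP => i k; rewrite !(mxE, sum2).
  by case: (I2 i) (I2 k) => [] -> [] -> /=; rewrite ?s10 ?G11; (field || ring); rewrite ?rN ?EN.
- by move=> v; rewrite quad !(mxE, sum2) /=; field.
Qed.

End Surface.

(* Main.v *)
Require Import Defs.
From HB Require Import structures.
From mathcomp Require Import all_boot all_order all_algebra.
From mathcomp Require Import all_classical all_reals all_analysis.
From mathcomp Require Import complex ring lra.

Set Implicit Arguments.
Unset Strict Implicit.
Unset Printing Implicit Defensive.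

Import Order.TTheory GRing.Theory Num.Theory.
Import numFieldNormedType.Exports.

Local Open Scope classical_set_scope.
Local Open Scope ring_scope.

(** Fix a chart and write the complex structure of [g] at [p] as the matrix
    [j = rotation (g p)]; its first column [c] is the fibre coordinate of the
    conformal section in Z.  The frame [a = (e1, c)] satisfies [a J0 = j a], so
    it lies over the section, and the frames [(e1, c + dc)] give explicit lifts
    to F of all tangent vectors of Z ([diff_nu_rep]).

    Since the (1,0)-forms of an almost complex structure [A] separate tangent
    vectors, [A v = v'] as soon as every (1,0)-form multiplies by [i] from [v]
    to [v'].  A structure adapted to [omega] and [eta] is therefore determined
    by them ([adapted_acs]): it maps the projection of one lift to the
    projection of another one when both [omega] and [eta] multiply by [i].  On
    the section, [omega] does so exactly when the base vector is rotated by
    [j] ([omega_rotate]).  Hence [[g]] is a holomorphic curve if and only if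
    [eta] is of type (1,0) along it, that is [eta (j w) = i eta w] for all [w]
    ([form_holomorphic_curve], [holomorphic_curve_form]).

    For J the form [eta] is the [zeta] of any connection in [P]; for JJ it is
    the conjugate of the [zeta] of the connection Ds of [P] preserving the area
    form.  Applying both conditions to Ds itself gives [zeta (j w) = i zeta w]
    and [zeta (j w) = - i zeta w], so [zeta] vanishes along the section.
    Conversely it vanishes for the Levi-Civita connection, which preserves the
    area form and so has the same Christoffel symbols as Ds, and then both
    conditions are trivial.

    What remains is that [zeta] vanishes along the section and the area form is
    parallel if and only if the metric is parallel ([levi_civitaP]): the
    components of [g] are functions of [sqrt (det g)] and [c], and the
    derivatives correspond ([parallel_metric]).

    In one direction the complex structure [w |-> j w] of the image surface must
    also be shown to be smooth and compatible with the charts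
    ([rotation_structure]); smoothness rests on that of the inverse square root
    of a positive smooth function ([smooth_rsqrt]). *)

(** * Calculus of smooth maps *)

Section Calculus.
Context {R : realType} {V : normedModType R}.

(** The differential is a local operator: it is characterised by the first-order
    expansion, which only sees germs. *)
Lemma near_eq_diff (W : normedModType R) (f g : V -> W) (x : V) :
  {near x, f =1 g} -> differentiable f x ->
  differentiable g x /\ 'd g x = 'd f x :> (V -> W).
Proof.
move=> fg df; have [cdf fE] := (diff_locallyP _ _).1 df.
have fgx : f x = g x := nbhs_singleton fg.
have gE : g \o shift x = cst (g x) + 'd f x +o_ (0 : V) id.
  apply/eqaddoP => eps eps0; move/eqaddoP : fE => /(_ eps eps0).
  have fg0 : \forall h \near (0 : V), f (h + x) = g (h + x).
    move: fg; rewrite (near_shift 0 x) => fg.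
    by near do [rewrite -[_ + x]/((shift x) _)]; move: fg; rewrite subr0.
  apply: filterS2 fg0 => h fgh.
  by rewrite -[X in _ -> `|X| <= _]/(g (h + x) - (g x + 'd f x h)) -fgh -fgx.
have dE := diff_unique cdf gE.
split; last exact: dE.
by apply/diff_locallyP; rewrite dE; split.
Unshelve. all: by end_near. Qed.

Lemma near_open (U : set V) (W : Type) (f g : V -> W) x : open U -> U x ->
  (forall y, U y -> f y = g y) -> {near x, f =1 g}.
Proof.
by move=> oU Ux fg; apply: filterS (open_nbhs_nbhs (conj oU Ux)) => y /fg.
Qed.

(** The formulas for derivatives of sums, products and entries hold only on [U];
    this lemma lets inductions on the order of differentiability use them. *)
Lemma Ck_eq (W : normedModType R) n (U : set V) (f g : V -> W) : open U ->
  (forall x, U x -> f x = g x) -> Ck n U f -> Ck n U g.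
Proof.
move=> oU; elim: n f g => [|n IH] f g fg /=.
  move=> cf x Ux; rewrite /prop_for /continuous_at -(fg x Ux).
  apply: cvg_trans (cf x Ux); apply: near_eq_cvg.
  exact: near_open oU Ux fg.
move=> [df Df]; split=> [x Ux|v].
  by have [] := near_eq_diff (near_open oU Ux fg) (df x Ux).
apply: IH (Df v) => x Ux; apply: near_eq_derive.
exact: near_open oU Ux fg.
Qed.

Lemma CkW (W : normedModType R) n (U : set V) (f : V -> W) :
  Ck n.+1 U f -> Ck n U f.
Proof.
elim: n f => [|n IH] f [df Df]; first by move=> x /df /differentiable_continuous.
by split=> // v; exact: IH.
Qed.

Lemma smooth_differentiable (W : normedModType R) (U : set V) (f : V -> W) x :
  smooth U f -> U x -> differentiable f x.
Proof. by move=> /(_ 1)[df _]; exact: df. Qed.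

Lemma smooth_derive (W : normedModType R) (U : set V) (f : V -> W) v :
  smooth U f -> smooth U (fun x => 'D_v f x).
Proof. by move=> sf n; have [_ Df] := sf n.+1; exact: Df. Qed.

Lemma Ck_cst (W : normedModType R) n (U : set V) (a : W) : open U ->
  Ck n U (fun=> a).
Proof.
move=> oU; elim: n a => [|n IH] a /=; first by move=> x _; exact: cvg_cst.
split=> [x _|v]; first exact: differentiable_cst.
by apply: Ck_eq (IH 0) => // x _; rewrite derive_cst.
Qed.

Lemma CkD (W : normedModType R) n (U : set V) (f g : V -> W) : open U ->
  Ck n U f -> Ck n U g -> Ck n U (fun x => f x + g x).
Proof.
move=> oU; elim: n f g => [|n IH] f g.
  by move=> cf cg x Ux; exact: (continuousD (cf x Ux) (cg x Ux)).
move=> [df Df] [dg Dg]; split=> [x Ux|v].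
  by apply: differentiableD; [exact: df|exact: dg].
apply: Ck_eq (IH _ _ (Df v) (Dg v)) => // x Ux.
by rewrite -deriveD //; apply: diff_derivable; [exact: df|exact: dg].
Qed.

Lemma CkM n (U : set V) (f g : V -> R^o) : open U ->
  Ck n U f -> Ck n U g -> Ck n U (fun x => f x * g x : R^o).
Proof.
move=> oU; elim: n f g => [|n IH] f g.
  by move=> cf cg x Ux; exact: (@continuousM R V f g x (cf x Ux) (cg x Ux)).
move=> Cf Cg; have [[df Df] [dg Dg]] := (Cf, Cg); split=> [x Ux|v].
  by apply: differentiableM; [exact: df|exact: dg].
have := CkD oU (IH _ _ (CkW Cf) (Dg v)) (IH _ _ (CkW Cg) (Df v)).
apply: Ck_eq => // x Ux.
by rewrite -deriveM //; apply: diff_derivable; [exact: df|exact: dg].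
Qed.

Lemma differentiable_mx m p (f : V -> 'M[R]_(m, p)) x :
  (forall i j, differentiable (fun y => f y i j : R^o) x) -> differentiable f x.
Proof.
move=> df; have -> : f = \sum_i \sum_j (fun y => f y i j *: delta_mx i j).
  apply/funext => y; rewrite [LHS]matrix_sum_delta fct_sumE.
  by apply: eq_bigr => i _; rewrite fct_sumE.
by apply: differentiable_sum => i; apply: differentiable_sum => j;
  exact: differentiableZl.
Qed.

Lemma differentiable_entry m p (f : V -> 'M[R]_(m, p)) x i j :
  differentiable f x -> differentiable (fun y => f y i j : R^o) x.
Proof.
move=> df; apply: (@differentiable_comp _ _ _ _ f (fun N => N i j : R^o)) => //.
exact: differentiable_coord.
Qed.

Lemma derive_entry m p (f : V -> 'M[R]_(m, p)) x v i j : differentiable f x ->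
  'D_v f x i j = 'D_v (fun y => f y i j : R^o) x.
Proof. by move=> df; rewrite derive_mx ?mxE//; exact: diff_derivable. Qed.

Lemma Ck_mx m p n (U : set V) (f : V -> 'M[R]_(m, p)) : open U ->
  (forall i j, Ck n U (fun x => f x i j : R^o)) -> Ck n U f.
Proof.
move=> oU; elim: n f => [|n IH] f Cf.
  move=> x Ux; apply/cvgrPdist_le => e e0.
  have near_entries : \forall y \near x, forall ij, `|f x ij.1 ij.2 - f y ij.1 ij.2| <= e.
    apply: filter_forall => -[i j].
    exact: ((cvgrPdist_le _ _).1 (Cf i j x Ux) _ e0).
  apply: filterS near_entries => y le_e.
  rewrite /Num.Def.normr/= mx_normrE (bigmax_le _ (ltW e0))//= => ij _.
  by rewrite !mxE; exact: le_e.
have df x : U x -> differentiable f x.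
  by move=> Ux; apply: differentiable_mx => i j; case: (Cf i j) => + _; exact.
split=> // v; apply: IH => i j; case: (Cf i j) => _ /(_ v).
by apply: Ck_eq => // x /df/derive_entry ->.
Qed.

Lemma Ck_entry m p n (U : set V) (f : V -> 'M[R]_(m, p)) i j : open U ->
  Ck n U f -> Ck n U (fun x => f x i j : R^o).
Proof.
move=> oU; elim: n f => [|n IH] f.
  move=> cf x Ux; apply: (@continuous_comp _ _ _ f (fun N => N i j)).
    exact: cf.
  exact: coord_continuous.
move=> [df Df]; split=> [x /df/differentiable_entry|v]; first exact.
by apply: Ck_eq (IH _ (Df v)) => // x /df/derive_entry ->.
Qed.

Lemma differentiable_sqrt (f : V -> R^o) x :
  differentiable f x -> 0 < f x -> differentiable (fun y => Num.sqrt (f y) : R^o) x.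
Proof.
move=> df f0; apply: (@differentiable_comp _ _ _ _ f (Num.sqrt : R^o -> R^o)) => //.
by apply/derivable1_diffP; case: (is_derive1_sqrt f0).
Qed.

(** The function [h = f ^ (-1/2)] solves [D_v h = - (1/2) h^3 D_v f], as one sees
    by differentiating [h h f = 1]; so one more derivative of [h] costs only
    products of functions already known to be differentiable. *)
Lemma smooth_rsqrt (U : set V) (f : V -> R^o) : open U -> smooth U f ->
  (forall x, U x -> 0 < f x) -> smooth U (fun x => (Num.sqrt (f x))^-1 : R^o).
Proof.
move=> oU sf f0; set h := fun x => _.
have h0 x : U x -> Num.sqrt (f x) != 0 by move=> /f0; rewrite -sqrtr_gt0 => /lt0r_neq0.
have dh x : U x -> differentiable h x.
  move=> Ux; apply: differentiableV; last exact: h0.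
  exact: differentiable_sqrt (smooth_differentiable sf Ux) (f0 x Ux).
have Dh v x : U x -> 'D_v h x = (- 2^-1 * (h x * (h x * h x))) * 'D_v f x.
  move=> Ux.
  have hhf y : U y -> h y * h y * f y = 1.
    move=> Uy; rewrite -[f y in LHS]sqr_sqrtr ?ltW ?f0// /h.
    by field; exact: h0.
  have dfx := diff_derivable (smooth_differentiable sf Ux).
  have dhx := diff_derivable (dh x Ux).
  have : 'D_v (h * h * f) x = 0.
    rewrite -(derive_cst (1 : R^o) x v); apply: near_eq_derive.
    exact: near_open oU Ux hhf.
  rewrite deriveM ?deriveM //; last exact: derivableM.
  rewrite /GRing.scale /= -[(h * h) x]/(h x * h x) => e.
  have e2 := hhf _ Ux.
  have hx : h x != 0 by rewrite invr_eq0 h0.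
  have fx : f x != 0 by rewrite gt_eqF ?f0.
  apply: (mulIf (_ : 2 * h x * f x != 0)); first by rewrite !mulf_neq0.
  transitivity (- (h x * h x * f x) * (h x * h x) * 'D_v f x); last by field.
  rewrite e2; apply/eqP; rewrite -subr_eq0 -e; apply/eqP; ring.
move=> n; elim: n => [|n IH] /=.
  by move=> x Ux; exact: differentiable_continuous (dh x Ux).
split=> // v; apply: (@Ck_eq _ _ _ (fun x => (- 2^-1 * (h x * (h x * h x))) * 'D_v f x)) => //.
  by move=> x Ux; rewrite Dh.
apply: CkM => //; last exact: smooth_derive.
by apply: CkM => //; [exact: Ck_cst|apply: CkM => //; exact: CkM].
Qed.

End Calculus.

Section Directional.
Context {R : realType}.

(** The difference quotients of an affine function along a line are constant, so
    the derivative exists without any continuity requirement. *)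
Lemma derive_affine (V W : normedModType R) (f : V -> W) a v u :
  (forall t : R, f (t *: v + a) = f a + t *: u) -> 'D_v f a = u.
Proof.
move=> fE; apply: cvg_lim => //; apply: cvg_near_cst.
near=> t; rewrite /= fE addrAC subrr add0r scalerA mulVf ?scale1r //.
by near: t; exact: nbhs_dnbhs_neq.
Unshelve. all: by end_near. Qed.

Lemma differentiable_fst (V W : normedModType R) (e : V * W) :
  differentiable (fst : V * W -> V) e.
Proof.
apply: (@linear_differentiable R (V * W)%type V fst) => z.
exact: cvg_fst.
Qed.

Lemma differentiable_snd (V W : normedModType R) (e : V * W) :
  differentiable (snd : V * W -> W) e.
Proof.
apply: (@linear_differentiable R (V * W)%type W snd) => z.
exact: cvg_snd.
Qed.

Lemma differentiable_entry_snd (V : normedModType R) m n (e : V * 'M[R]_(m, n)) i j :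
  differentiable (fun e' : V * 'M[R]_(m, n) => e'.2 i j : R^o) e.
Proof. exact: differentiable_entry (differentiable_snd e). Qed.

End Directional.

(** * Algebra of the oriented plane *)

Section PlaneAlgebra.
Context {R : realType}.
Implicit Types (a g h : 'M[R]_2) (c : 'cV[R]_2).

Lemma ord2P (i : 'I_2) : i = 0 \/ i = 1.
Proof. by case: i => [[|[|//]] ?]; [left|right]; exact/val_inj. Qed.

Lemma sum2 (F : 'I_2 -> R) : \sum_i F i = F 0 + F 1.
Proof.
by rewrite big_ord_recr big_ord1; congr (F _ + F _); exact/val_inj.
Qed.

Lemma det2 a : \det a = a 0 0 * a 1 1 - a 0 1 * a 1 0.
Proof.
have l00 : lift (0 : 'I_2) (0 : 'I_1) = 1 by exact/val_inj.
have l10 : lift (1 : 'I_2) (0 : 'I_1) = 0 by exact/val_inj.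
rewrite (expand_det_row _ 0) sum2 /cofactor !det_mx11 !mxE /= expr0 expr1.
by rewrite l00 l10 mul1r mulN1r mulrN.
Qed.

Lemma invmx2 a : \det a != 0 -> invmx a = (\det a)^-1 *:
  \matrix_(i, j) (if i == 0 then if j == 0 then a 1 1 else - a 0 1
                  else if j == 0 then - a 1 0 else a 0 0).
Proof.
move=> a0; have au : a \in unitmx by rewrite unitmxE unitfE.
apply: (can_inj (mulKmx au)); rewrite mulmxV // -scalemxAr.
apply/matrixP => i j; rewrite !(mxE, sum2) /=.
by case: (ord2P i) (ord2P j) => [] -> [] -> /=;
  move: a0; rewrite det2 => a0; field.
Qed.

Lemma matrix2P m (A B : 'M[R]_(2, m)) :
  (forall j, A 0 j = B 0 j) -> (forall j, A 1 j = B 1 j) -> A = B.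
Proof. by move=> e0 e1; apply/matrixP => i j; case: (ord2P i) => ->. Qed.

Lemma rotationE g : 0 < \det g -> rotation g = (Num.sqrt (\det g))^-1 *:
  \matrix_(i, j) (if i == 0 then if j == 0 then - g 0 1 else - g 1 1
                  else if j == 0 then g 0 0 else g 1 0).
Proof.
move=> g0; have s0 : Num.sqrt (\det g) != 0 by rewrite gt_eqF ?sqrtr_gt0.
rewrite /rotation invmx2 ?gt_eqF // -scalemxAl scalerA.
have -> : Num.sqrt (\det g) / \det g = (Num.sqrt (\det g))^-1.
  by rewrite -{2}(sqr_sqrtr (ltW g0)) expr2 invfM mulrA divff // mul1r.
congr (_ *: _); apply/matrixP => i j; rewrite !(mxE, sum2) /=.
by case: (ord2P i) (ord2P j) => [] -> [] -> /=; ring.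
Qed.

Lemma trmx_J0 a : a^T *m J0 *m a = \det a *: J0.
Proof.
apply/matrixP => i j; rewrite det2 !(mxE, sum2) /=.
by case: (ord2P i) (ord2P j) => [] -> [] -> /=; ring.
Qed.

(** Rotation by a right angle is natural under orientation preserving
    isometries: [a^T J0 a = det a J0] is compensated by the area density
    [sqrt (det g)]. *)
Lemma rotation_pullback g h a : 0 < \det a -> 0 < \det h ->
  g = a^T *m h *m a -> a *m rotation g = rotation h *m a.
Proof.
move=> a0 h0 ->; have au : a \in unitmx by rewrite unitmxE unitfE gt_eqF.
have hu : h \in unitmx by rewrite unitmxE unitfE gt_eqF.
have atu : a^T \in unitmx by rewrite unitmx_tr.
have gu : a^T *m h *m a \in unitmx by rewrite !unitmx_mul atu hu au.
rewrite /rotation -scalemxAr -scalemxAl; apply: (can_inj (mulKmx hu)).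
apply: (can_inj (mulKmx atu)); rewrite -!scalemxAr !mulmxA mulmxK //.
rewrite -/(a^T *m h *m a) mulmxV // mul1mx trmx_J0 scalerA.
have -> : \det (a^T *m h *m a) = \det a ^+ 2 * \det h.
  by rewrite !det_mulmx det_tr; ring.
rewrite sqrtrM ?sqr_ge0 // sqrtr_sqr ger0_norm ?ltW //.
by rewrite mulrC.
Qed.

(** The frame [(e1, c)].  Its complex structure [a J0 a^-1] maps [e1] to [c], so
    this is a global section of frames over the upper half plane of complex
    structures, and it is affine in the coordinate [c]. *)
Definition frame_of_col c : 'M[R]_2 :=
  \matrix_(i, j) if j == 0 then (i == 0)%:R else c i 0.

(** The derivative of [frame_of_col] in the direction [c]. *)
Definition second_col c : 'M[R]_2 := \matrix_(i, j) if j == 0 then 0 else c i 0.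

Lemma frame_of_colD c c' : frame_of_col (c + c') = frame_of_col c + second_col c'.
Proof.
by apply/matrixP => i j; rewrite !mxE; case: (j == 0); rewrite ?addr0.
Qed.

Lemma second_colZ (t : R) c : second_col (t *: c) = t *: second_col c.
Proof. by apply/matrixP => i j; rewrite !mxE; case: (j == 0); rewrite ?mulr0. Qed.

Lemma det_frame_of_col c : \det (frame_of_col c) = c 1 0.
Proof. by rewrite det2 !mxE /=; ring. Qed.

Lemma col0_conj_J0 a : \det a != 0 -> col 0 (a *m J0 *m invmx a) =
  (\det a)^-1 *: \col_i (if i == 0 then a 0 1 * a 1 1 + a 0 0 * a 1 0
                         else a 1 1 * a 1 1 + a 1 0 * a 1 0).
Proof.
move=> a0; rewrite invmx2 // -scalemxAr linearZ /=; congr (_ *: _).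
by apply: matrix2P => j; rewrite !(mxE, sum2) /=; ring.
Qed.

Lemma frame_of_col_J0 c : 0 < c 1 0 ->
  col 0 (frame_of_col c *m J0 *m invmx (frame_of_col c)) = c.
Proof.
move=> c0; have cN := lt0r_neq0 c0; rewrite col0_conj_J0 det_frame_of_col //.
by apply: matrix2P => j; rewrite ord1 !mxE /=; field.
Qed.

Lemma oriented_complex_col (j : 'M[R]_2) : oriented_complex j -> 0 < (col 0 j) 1 0.
Proof.
case=> _ /(_ (\col_i (i == 0)%:R : 'cV[R]_2)); set v := \col_i _; have v0 : v != 0.
  by apply/eqP => /matrixP/(_ 0 0)/eqP; rewrite !mxE oner_eq0.
move=> /(_ v0); rewrite det2.
have r0 i : (row_mx v (j *m v) : 'M[R]_2) i 0 = v i 0.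
  by rewrite -[RHS](row_mxEl v (j *m v)); congr (_ _ _); exact/val_inj.
have r1 i : (row_mx v (j *m v) : 'M[R]_2) i 1 = (j *m v) i 0.
  by rewrite -[RHS](row_mxEr v (j *m v)); congr (_ _ _); exact/val_inj.
by rewrite !r0 !r1 !(mxE, sum2) /=; lra.
Qed.

(** Test vectors: [e1] for the entry, and [(- g 0 1, g 0 0)], orthogonal to
    [e1], for the determinant. *)
Lemma symmetric_det_gt0 g : g^T = g ->
  (forall v : 'cV[R]_2, v != 0 -> 0 < (v^T *m g *m v) 0 0) ->
  0 < g 0 0 /\ 0 < \det g.
Proof.
move=> gsym gpos.
have s10 : g 1 0 = g 0 1 by rewrite -[in LHS]gsym mxE.
pose vec (x y : R) : 'cV[R]_2 := \col_i (if i == 0 then x else y).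
have quad x y : (x != 0) || (y != 0) ->
    0 < x * x * g 0 0 + 2 * x * y * g 0 1 + y * y * g 1 1.
  move=> xy; have /gpos : vec x y != 0.
    apply/eqP => /matrixP e; move: xy (e 0 0) (e 1 0).
    by rewrite !mxE /= => /orP[]/eqP.
  by rewrite !(mxE, sum2) /= s10; congr (0 < _); ring.
have g00 : 0 < g 0 0 by have := quad 1 0; rewrite oner_neq0 => /(_ isT); lra.
split=> //; rewrite det2 s10 -(pmulr_rgt0 _ g00).
have := quad (- g 0 1) (g 0 0); rewrite (lt0r_neq0 g00) orbT => /(_ isT).
by congr (0 < _); ring.
Qed.

(** The pointwise core.  With [s = sqrt (det g)] the metric is
    [g 0 0 = s c1], [g 0 1 = - s c0], [g 1 1 = s (1 + c0^2) / c1]; the last three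
    hypotheses are the derivatives of these relations in some direction, where
    [dg], [dc], [ds] are the derivatives and [G] is the connection matrix.
    The three equations [dg = G^T g + g G] are then equivalent to one equation
    on the volume and two on the conformal class, which are the real and
    imaginary part of [zeta]. *)
Lemma parallel_metric (g dg G : 'M[R]_2) (c dc : 'cV[R]_2) (s ds : R) :
  0 < s -> 0 < c 1 0 -> g^T = g -> dg^T = dg ->
  s * s = \det g -> s * c 0 0 = - g 0 1 -> s * c 1 0 = g 0 0 ->
  ds * s + s * ds = dg 0 0 * g 1 1 + g 0 0 * dg 1 1 - 2 * g 0 1 * dg 0 1 ->
  ds * c 0 0 + s * dc 0 0 = - dg 0 1 ->
  ds * c 1 0 + s * dc 1 0 = dg 0 0 ->
  let th := invmx (frame_of_col c) *m (second_col dc + G *m frame_of_col c) in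
  dg = G^T *m g + g *m G <->
  [/\ ds = \tr G * s, th 0 0 - th 1 1 = 0 & th 0 1 + th 1 0 = 0].
Proof.
move=> s0 c0 gsym dgsym sE g01 g00 dsE dg01 dg00 th.
have sN := lt0r_neq0 s0; have cN := lt0r_neq0 c0.
have g10 : g 1 0 = g 0 1 by rewrite -[in LHS]gsym mxE.
have dg10 : dg 1 0 = dg 0 1 by rewrite -[in LHS]dgsym mxE.
move: sE; rewrite det2 g10 => sE.
have g01' : g 0 1 = - (s * c 0 0) by rewrite g01 opprK.
have g11 : g 1 1 = s * (1 + c 0 0 * c 0 0) / c 1 0.
  apply: (mulfI (_ : s * c 1 0 != 0)); first by rewrite mulf_neq0.
  transitivity (s * s + s * c 0 0 * (s * c 0 0)); last by field.
  by rewrite g01 sE g00; ring.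
have thE : th 0 0 - th 1 1 = G 0 0 - G 1 1 - (2 * c 0 0 * G 1 0 + dc 1 0) / c 1 0 /\
  th 0 1 + th 1 0 = G 0 0 * c 0 0 + G 0 1 * c 1 0 + dc 0 0 + G 1 0 / c 1 0
    - c 0 0 * (G 1 0 * c 0 0 + G 1 1 * c 1 0 + dc 1 0) / c 1 0.
  rewrite /th invmx2 det_frame_of_col // -scalemxAl !(mxE, sum2) /=.
  by split; field.
have trE : \tr G = G 0 0 + G 1 1 by rewrite /mxtrace sum2.
case: thE => -> ->; rewrite trE.
have entries i j : (G^T *m g + g *m G) i j =
    G 0 i * g 0 j + G 1 i * g 1 j + (g i 0 * G 0 j + g i 1 * G 1 j).
  by rewrite !(mxE, sum2).
have s2 : 2 * s != 0 by rewrite mulf_neq0 // pnatr_eq0.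
split=> [dgE|[dsG z1 z2]].
  have d00 : dg 0 0 = 2 * (g 0 0 * G 0 0 + g 0 1 * G 1 0).
    by rewrite dgE entries g10; ring.
  have d01 : dg 0 1 = g 0 0 * G 0 1 + g 0 1 * G 1 1 + G 0 0 * g 0 1 + G 1 0 * g 1 1.
    by rewrite dgE entries; ring.
  have d11 : dg 1 1 = 2 * (g 0 1 * G 0 1 + g 1 1 * G 1 1).
    by rewrite dgE entries g10; ring.
  have dsG : ds = (G 0 0 + G 1 1) * s.
    apply: (mulfI s2); transitivity (ds * s + s * ds); first by ring.
    by rewrite dsE d00 d01 d11 -g00 g01' g11; field.
  have dc1 : dc 1 0 = (dg 0 0 - ds * c 1 0) / s.
    by rewrite -dg00; field.
  have dc0 : dc 0 0 = (- dg 0 1 - ds * c 0 0) / s.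
    by rewrite -dg01; field.
  by split=> //; rewrite dc1 ?dc0 d00 ?d01 dsG -g00 g01' ?g11; field; rewrite cN sN.
have dc1 : dc 1 0 = (G 0 0 - G 1 1) * c 1 0 - 2 * c 0 0 * G 1 0.
  by apply: (mulIf (invr_neq0 cN)); apply/eqP; rewrite -subr_eq0 -oppr_eq0 -z1;
  apply/eqP; field.
have dc0 : dc 0 0 = c 0 0 * (G 1 0 * c 0 0 + G 1 1 * c 1 0 + dc 1 0) / c 1 0
   - (G 0 0 * c 0 0 + G 0 1 * c 1 0 + G 1 0 / c 1 0).
  by apply/eqP; rewrite -subr_eq0 -z2; apply/eqP; field.
have e00 : dg 0 0 = (G^T *m g + g *m G) 0 0.
  by rewrite entries -dg00 dsG dc1 g10 -g00 g01'; ring.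
have e01 : dg 0 1 = (G^T *m g + g *m G) 0 1.
  rewrite entries -[LHS]opprK -dg01 dsG dc0 dc1 -g00 g01' g11; field.
  by [].
have e11 : dg 1 1 = (G^T *m g + g *m G) 1 1.
  have -> : dg 1 1 = (ds * s + s * ds - dg 0 0 * g 1 1 + 2 * g 0 1 * dg 0 1) / g 0 0.
    by rewrite dsE; field; rewrite -g00 mulf_neq0.
  rewrite e00 e01 !entries dsG g10 -g00 g01' g11; field.
  by rewrite cN.
apply/matrixP => i j; case: (ord2P i) (ord2P j) => [] -> [] -> //.
by rewrite dg10 e01 !entries g10; ring.
Qed.

End PlaneAlgebra.

(** * Charts of the surface and of its frame bundle *)

Section Charts.
Context {R : realType} {M : oriented_surface (R := R)}.
Implicit Types (k l m : idx (atlas M)) (x : M) (p q : 'cV[R]_2).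

Lemma open_cod k : open (cod (X := atlas M) k).
Proof. by have [_ _ _ []] := atlas_smooth M. Qed.

Lemma psiK k x : dom k x -> psi k (phi k x) = x.
Proof. by move=> dx; have [_ _ _ [_ _ /(_ k x dx)[]]] := atlas_smooth M. Qed.

Lemma cod_phi k x : dom k x -> cod k (phi k x).
Proof. by move=> dx; exists x. Qed.

Lemma dom_psi k p : cod (X := atlas M) k p -> dom k (psi k p).
Proof. by case=> x dx <-; rewrite psiK. Qed.

Lemma phiK k p : cod (X := atlas M) k p -> phi k (psi k p) = p.
Proof. by case=> x dx <-; rewrite psiK. Qed.

Lemma overlapP k l p :
  overlap (X := atlas M) k l p <-> cod k p /\ dom l (psi k p).
Proof.
split=> [[x [dk dl] <-]|[kp dl]]; first by rewrite psiK //; split=> //; exists x.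
by exists (psi k p); [split=> //; exact: dom_psi|exact: phiK].
Qed.

Lemma near_cod k p : cod (X := atlas M) k p -> \forall q \near p, cod k q.
Proof. by move=> kp; apply: open_nbhs_nbhs; split=> //; exact: open_cod. Qed.

Lemma near_dom_psi k l p : cod k p -> dom l (psi k p) ->
  \forall q \near p, dom l (psi k q).
Proof.
move=> kp dl; have [_ _ _ [/(_ l) odl _ _ /(_ k) cpsi _]] := atlas_smooth M.
by apply: (cpsi p _ (dom l)); [rewrite inE|exact: open_nbhs_nbhs].
Qed.

Lemma tr_differentiable k l p : cod k p -> dom l (psi k p) ->
  differentiable (tr k l) p.
Proof.
move=> kp dl; have [_ _ _ [_ _ _ _ /(_ k l) str]] := atlas_smooth M.
by apply: (smooth_differentiable str); apply/overlapP.
Qed.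

Lemma mul_jac (f : 'cV[R]_2 -> 'cV[R]_2) p v : jac f p *m v = 'd f p v.
Proof.
rewrite [in RHS](matrix_sum_delta v) linear_sum; apply/matrixP => i j.
rewrite ord1 mxE summxE; apply: eq_bigr => a _.
by rewrite big_ord1 linearZ !mxE mulrC.
Qed.

Lemma jac_eq (A : 'M[R]_2) f p : (forall v, 'd f p v = A *m v) -> jac f p = A.
Proof.
move=> fA; apply/matrixP => i j; rewrite mxE fA mxE (bigD1 j) //= big1 ?addr0.
  by rewrite mxE !eqxx mulr1.
by move=> a /negPf aj; rewrite mxE aj mulr0.
Qed.

Lemma near_tr_id k p : cod k p -> {near p, id =1 tr k k}.
Proof. by move=> /near_cod; apply: filterS => q kq; exact/esym/phiK. Qed.

Lemma jac_at_id k x : dom k x -> jac_at k k x = 1%:M.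
Proof.
move=> dx; apply: jac_eq => v; rewrite mul1mx.
have did : differentiable (@id 'cV[R]_2) (phi k x) by case: (is_diff_id (phi k x)).
have [_ ->] := near_eq_diff (near_tr_id (cod_phi dx)) did.
by rewrite diff_val.
Qed.

Lemma jac_at_comp k l m x : dom k x -> dom l x -> dom m x ->
  jac_at k m x = jac_at l m x *m jac_at k l x.
Proof.
move=> dk dl dm; apply: jac_eq => v; rewrite -mulmxA !mul_jac.
have trE : tr k l (phi k x) = phi l x by rewrite /tr /trans /= psiK.
have dkl : differentiable (tr k l) (phi k x).
  by apply: tr_differentiable; [exact: cod_phi|rewrite psiK].
have dlm : differentiable (tr l m) (tr k l (phi k x)).
  by rewrite trE; apply: tr_differentiable; [exact: cod_phi|rewrite psiK].
have near_comp : {near phi k x, tr l m \o tr k l =1 tr k m}.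
  have : \forall q \near phi k x, dom l (psi k q).
    by apply: near_dom_psi; [exact: cod_phi|rewrite psiK].
  by apply: filterS => q dlq; rewrite /tr /trans /= psiK.
have dc : differentiable (tr l m \o tr k l) (phi k x) by exact: differentiable_comp.
have [_ dE] := near_eq_diff near_comp dc.
rewrite -trE; transitivity ('d (tr l m \o tr k l) (phi k x) v).
  exact: (congr1 (@^~ v) dE).
exact: (congr1 (@^~ v) (diff_comp dkl dlm)).
Qed.

Lemma jac_at_gt0 k l x : dom k x -> dom l x -> 0 < \det (jac_at k l x).
Proof.
move=> dk dl; apply: atlas_oriented; apply/overlapP.
by rewrite psiK //; split=> //; exact: cod_phi.
Qed.

(** A matrix in one chart extends to a frame in all charts by the cocycle of
    Jacobians, which are positive because the atlas is oriented. *)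
Lemma cod_frame_bundle k p (a : 'M[R]_2) : cod k p -> 0 < \det a ->
  cod (X := frame_bundle M) k (p, a).
Proof.
move=> kp a0; have dx := dom_psi kp; exists (psi (c := frame_bundle M) k (p, a)).
  split=> //=; split=> [l dl|l m dl dm|l ndl] /=.
  - by rewrite mem_set // det_mulmx mulr_gt0 // jac_at_gt0.
  - rewrite (mem_set dl) (mem_set dm) (jac_at_comp dx dl dm).
    exact: esym (mulmxA _ _ _).
  - by rewrite memNset.
by rewrite /= mem_set // jac_at_id // mul1mx phiK.
Qed.

Definition nu_rep k := local_rep (X := frame_bundle M) (Y := Zbundle M) (@nu R M) k k.

Lemma nu_repE k e : cod (X := atlas M) k e.1 ->
  nu_rep k e = (e.1, col 0 (e.2 *m J0 *m invmx e.2)).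
Proof.
move=> ke; rewrite /nu_rep /local_rep /= mem_set; last exact: dom_psi.
by rewrite jac_at_id ?mul1mx ?phiK //; exact: dom_psi.
Qed.

End Charts.

(** * The projection from frames to complex structures *)

Section Projection.
Context {R : realType} {M : oriented_surface (R := R)}.
Implicit Types (k l : idx (atlas M)) (x : M) (p q c : 'cV[R]_2).

Lemma nu_rep_differentiable k (e : 'cV[R]_2 * 'M[R]_2) : cod k e.1 -> 0 < \det e.2 ->
  differentiable (nu_rep k) e.
Proof.
move=> ke e0.
pose det' (y : 'cV[R]_2 * 'M[R]_2) : R^o := y.2 0 0 * y.2 1 1 - y.2 0 1 * y.2 1 0.
have det'E y : \det y.2 = det' y by rewrite det2.
have ddet : differentiable det' e.
  by apply: differentiableB; apply: differentiableM; exact: differentiable_entry_snd.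
pose num (i : 'I_2) (y : 'cV[R]_2 * 'M[R]_2) : R^o :=
  if i == 0 then y.2 0 1 * y.2 1 1 + y.2 0 0 * y.2 1 0
  else y.2 1 1 * y.2 1 1 + y.2 1 0 * y.2 1 0.
have dnum i : differentiable (num i) e.
  have dmul a b i1 j1 : differentiable
      (fun y : 'cV[R]_2 * 'M[R]_2 => y.2 a b * y.2 i1 j1 : R^o) e.
    by apply: differentiableM; exact: differentiable_entry_snd.
  rewrite /num; case: (i == 0).
    exact: differentiableD (dmul 0 1 1 1) (dmul 0 0 1 0).
  exact: differentiableD (dmul 1 1 1 1) (dmul 1 0 1 0).
pose f (y : 'cV[R]_2 * 'M[R]_2) : 'cV[R]_2 * 'cV[R]_2 :=
  (y.1, \matrix_(i, j) ((det' y)^-1 * num i y)).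
have df : differentiable f e.
  apply: differentiable_pair; first exact: differentiable_fst.
  apply: differentiable_mx => i j.
  rewrite [X in differentiable X _](_ : _ = (fun y => (det' y)^-1) * num i :> (_ -> R^o));
    last by apply/funext => y; rewrite mxE.
  apply: differentiableM => //; apply: differentiableV => //.
  by rewrite -det'E gt_eqF.
have near_f : {near e, f =1 nu_rep k}.
  have near_det : \forall y \near e, 0 < det' y.
    have det'0 : 0 < det' e by rewrite -det'E.
    exact: (cvgr_gt (det' e) (differentiable_continuous ddet) _ det'0).
  have near_base : \forall y \near e, cod (X := atlas M) k y.1.
    exact: (differentiable_continuous (differentiable_fst e) (near_cod ke)).
  apply: filterS2 near_det near_base => y y0 ky.
  rewrite nu_repE // col0_conj_J0 det'E ?gt_eqF // /f; congr (_, _).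
  by apply/matrixP => i j; rewrite !mxE /num.
by have [] := near_eq_diff near_f df.
Qed.

(** The map [(p, c) |-> (p, (e1, c))] is an affine section of [nu], so the vector
    [(w, dc)] of Z lifts to [(w, (0, dc))]: no formula for the differential of
    [nu] on general vectors is needed. *)
Lemma diff_nu_rep k p c w dc : cod k p -> 0 < c 1 0 ->
  'd (nu_rep k) (p, frame_of_col c) (w, second_col dc) = (w, dc).
Proof.
move=> kp c0.
pose lift (y : 'cV[R]_2 * 'cV[R]_2) : 'cV[R]_2 * 'M[R]_2 := (y.1, frame_of_col y.2).
have dlift y : differentiable lift y.
  apply: differentiable_pair; first exact: differentiable_fst.
  apply: differentiable_mx => i j.
  rewrite [X in differentiable X _](_ : _ =
    (fun y' => if j == 0 then (i == 0)%:R else y'.2 i 0 : R^o)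
      :> ('cV[R]_2 * 'cV[R]_2 -> R^o)); last first.
    by apply/funext => y'; rewrite mxE.
  case: (j == 0); first exact: differentiable_cst.
  exact: differentiable_entry_snd.
have dliftE : 'd lift (p, c) (w, dc) = (w, second_col dc).
  rewrite -deriveE //; apply: derive_affine => t.
  by rewrite /lift /= (addrC (t *: dc)) frame_of_colD second_colZ (addrC (t *: w)).
have dnu : differentiable (nu_rep k) (lift (p, c)).
  by apply: nu_rep_differentiable; rewrite //= det_frame_of_col.
have near_id : {near (p, c), id =1 nu_rep k \o lift}.
  have near_pos : \forall y \near (p, c), 0 < (y.2 : 'cV[R]_2) 1 0.
    exact: (cvgr_gt (c 1 0)
      (differentiable_continuous (differentiable_entry_snd (p, c) 1 0)) _ c0).
  have near_base : \forall y \near (p, c), cod (X := atlas M) k y.1.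
    exact: (differentiable_continuous (differentiable_fst (p, c)) (near_cod kp)).
  apply: filterS2 near_pos near_base => -[q c'] /= c'0 kq.
  by rewrite nu_repE //= frame_of_col_J0.
have did : differentiable (@id ('cV[R]_2 * 'cV[R]_2)%type) (p, c).
  by case: (is_diff_id (p, c)).
have [_ dE] := near_eq_diff near_id did.
rewrite -dliftE -[LHS]/(('d (nu_rep k) (lift (p, c)) \o 'd lift (p, c)) (w, dc)).
rewrite -(congr1 (@^~ (w, dc)) (diff_comp (dlift (p, c)) dnu)).
by rewrite (congr1 (@^~ (w, dc)) dE) diff_val.
Qed.

End Projection.

(** * Adapted almost complex structures *)

Section Adapted.
Context {R : realType} {M : oriented_surface (R := R)}.
Implicit Types (k : idx (atlas M)) (p c w dc : 'cV[R]_2) (D : connection M).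

Definition imag : R[i] := (0 +i* 1)%C.

Lemma cod_Zbundle k p c : cod (X := Zbundle M) k (p, c) -> cod k p /\ 0 < c 1 0.
Proof.
case=> -[x j] [/= dx [jx _ _]] [<- <-]; split; first exact: cod_phi.
exact: oriented_complex_col (jx k dx).
Qed.

(** Every real linear form is the imaginary part of a (1,0)-form; this is why
    (1,0)-forms separate tangent vectors. *)
Lemma form10_of_linear (E : normedModType R) (A : E -> E) (b : {linear E -> R^o}) :
  linear A -> (forall v, A (A v) = - v) -> form10 A (fun v => (b (A v) +i* b v)%C).
Proof.
move=> lA AA; split=> [v w|r v|v].
- have -> : A (v + w) = A v + A w by rewrite -[v in LHS]scale1r lA scale1r.
  by rewrite !linearD.
- have A0 : A 0 = 0 by have := lA (-1) 0 0; rewrite scaler0 addr0 scaleN1r addNr.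
  have -> : A (r *: v) = r *: A v by rewrite -[r *: v]addr0 lA A0 addr0.
  by rewrite !linearZ /=; simpc.
- by rewrite AA linearN /=; simpc.
Qed.

(** The tangent vector of F at the frame [(e1, c)] that projects to [(w, dc)]. *)
Definition lift_vec w dc : 'cV[R]_2 * 'M[R]_2 := (w, second_col dc).

(** A (1,0)-form [alpha] pulls back to a combination of [omega] and [eta], so the
    hypotheses give [alpha (w', dc') = i alpha (w, dc) = alpha (J (w, dc))]; the
    imaginary parts of such forms exhaust the real linear forms. *)
Lemma adapted_acs eta (J : almost_complex (Zbundle M)) k p c w dc w' dc' :
  adapted eta J -> cod (X := Zbundle M) k (p, c) ->
  let e := (p, frame_of_col c) in
  omega e (lift_vec w' dc') = imag * omega e (lift_vec w dc) ->
  eta k e (lift_vec w' dc') = imag * eta k e (lift_vec w dc) ->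
  J k (p, c) (w, dc) = (w', dc').
Proof.
move=> adJ kpc e omega_i eta_i; have [kp c0] := cod_Zbundle kpc.
have ke : cod (X := frame_bundle M) k e.
  by apply: cod_frame_bundle => //; rewrite det_frame_of_col.
have nuE : nu_rep k e = (p, c) by rewrite nu_repE //= frame_of_col_J0.
have coord (b : {linear ('cV[R]_2 * 'cV[R]_2)%type -> R^o}) :
    b (J k (p, c) (w, dc)) = b (w', dc').
  have f10 := form10_of_linear b (acs_linear J kpc)
    (fun v => acs_square J v kpc).
  have pullback : forall alpha, form10 (J k (nu_rep k e)) alpha ->
    exists c1 c2 : R[i], forall v,
    alpha ('d (nu_rep k) e v) = c1 * omega e v + c2 * eta k e v := adJ k e ke.
  move: pullback; rewrite nuE => /(_ _ f10)[c1 [c2 pull]].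
  have := pull (lift_vec w' dc'); have := pull (lift_vec w dc).
  rewrite !diff_nu_rep // omega_i eta_i => pull1 pull2.
  have : (b (J k (p, c) (w', dc')) +i* b (w', dc'))%C =
         imag * (b (J k (p, c) (w, dc)) +i* b (w, dc))%C.
    by rewrite pull1 pull2; ring.
  by rewrite /imag; simpc => -[_ ->].
pose b1 i (v : 'cV[R]_2 * 'cV[R]_2) : R^o := v.1 i 0.
pose b2 i (v : 'cV[R]_2 * 'cV[R]_2) : R^o := v.2 i 0.
have lb1 i : linear (b1 i) by move=> r u v; rewrite /b1 !mxE.
have lb2 i : linear (b2 i) by move=> r u v; rewrite /b2 !mxE.
pose L1 i : {linear _ -> _} := HB.pack (b1 i) (GRing.isLinear.Build _ _ _ _ _ (lb1 i)).
pose L2 i : {linear _ -> _} := HB.pack (b2 i) (GRing.isLinear.Build _ _ _ _ _ (lb2 i)).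
rewrite [LHS]surjective_pairing; congr (_, _); apply/matrixP => i j; rewrite ord1.
  exact: (coord (L1 i)).
exact: (coord (L2 i)).
Qed.

(** The vertical part of [zeta] identifies the tangent spaces of the fibres of Z
    with the complex numbers.  The witness solves the two real equations, which
    are triangular in the entries of [dc]. *)
Lemma zeta_lift_surj D k p c w (z : R[i]) : 0 < c 1 0 ->
  exists dc, zeta D k (p, frame_of_col c) (lift_vec w dc) = z.
Proof.
move=> c0; have cN := lt0r_neq0 c0.
pose T := D k p w *m frame_of_col c.
exists (\col_i if i == 0 then (complex.Im z - T 1 0 / c 1 0 - T 0 1)
   + c 0 0 * (T 0 0 - c 0 0 / c 1 0 * T 1 0 - complex.Re z)
   else c 1 0 * (T 0 0 - c 0 0 / c 1 0 * T 1 0 - complex.Re z) - T 1 1).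
rewrite /zeta /connection_form /lift_vec /= -/T invmx2 det_frame_of_col //.
rewrite -!scalemxAl [LHS](_ : _ = (complex.Re z +i* complex.Im z)%C); last first.
  by congr (_ +i* _)%C; rewrite !(mxE, sum2) /=; field.
by case: z.
Qed.

(** In the frame [a = (e1, j e1)] the endomorphism [j] becomes [J0], which is
    multiplication by [i] under the identification of [R^2] with the complex
    numbers used by [omega]. *)
Lemma omega_rotate (j : 'M[R]_2) p w dc dc' : oriented_complex j ->
  let e := (p, frame_of_col (col 0 j)) in
  omega e (lift_vec (j *m w) dc') = imag * omega e (lift_vec w dc).
Proof.
move=> jc e; have c0 := oriented_complex_col jc; case: jc => jj _.
pose a := frame_of_col (col 0 j).
have au : a \in unitmx by rewrite unitmxE unitfE det_frame_of_col gt_eqF.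
have jcol i : (j *m j) i 0 = (- 1%:M : 'M[R]_2) i 0 by rewrite jj.
have aJ : j *m a = a *m J0.
  apply/matrixP => i l; have := jcol i; rewrite !(mxE, sum2).
  by case: (ord2P l) => -> /=; rewrite ?mxE /=; case: (ord2P i) => -> /=; lra.
have conj_j : invmx a *m (j *m w) = J0 *m (invmx a *m w).
  apply: (can_inj (mulKmx au)).
  by rewrite mulKVmx // [RHS]mulmxA -aJ -mulmxA mulKVmx.
rewrite /omega /tautological /= -/a conj_j.
by rewrite /imag !(mxE, sum2) /=; simpc; congr (_ +i* _)%C; ring.
Qed.

(** The two holomorphicity conditions force opposite factors: [z' = i z] and,
    after conjugation of the second one, [z' = - i z]. *)
Lemma eq0_of_imag_conj (z z' : R[i]) :
  z' = imag * z -> (z'^*)%C = imag * (z^*)%C -> z = 0.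
Proof.
case: z z' => a b [a' b']; rewrite /imag; simpc => -[e1 e2] [e3 e4].
by congr (_ +i* _)%C; lra.
Qed.

End Adapted.

(** * The conformal section and its image *)

Section ConformalSection.
Context {R : realType} {M : oriented_surface (R := R)} (g : metric M).
Implicit Types (k l : idx (atlas M)) (x : M) (p q w : 'cV[R]_2).

Lemma metric_det_gt0 k p : cod k p -> 0 < g k p 0 0 /\ 0 < \det (g k p).
Proof.
move=> kp; apply: symmetric_det_gt0; first exact: gmx_sym.
by move=> v; exact: gmx_pos.
Qed.

Lemma rotation_oriented k p : cod k p -> oriented_complex (rotation (g k p)).
Proof.
move=> kp; have [] // := @rotationP R (g k p); first exact: gmx_sym.
by move=> v; exact: gmx_pos.
Qed.

Lemma rotation_jac k l p : cod k p -> dom l (psi k p) ->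
  jac (tr k l) p *m rotation (g k p) = rotation (g l (tr k l p)) *m jac (tr k l) p.
Proof.
move=> kp dl; have klp : overlap (X := atlas M) k l p by apply/overlapP.
have lq : cod l (tr k l p) by exact: cod_phi.
apply: rotation_pullback; last exact: gmx_compat.
  exact: atlas_oriented.
by have [] := metric_det_gt0 lq.
Qed.

Lemma dom_conformal_section k x : dom k x ->
  dom (c := Zbundle M) k (conformal_section g x).
Proof.
move=> dk; split=> //=; split=> /= [l dl|l m dl dm|l ndl].
- by rewrite mem_set //; apply: rotation_oriented; exact: cod_phi.
- rewrite (mem_set dl) (mem_set dm) /jac_at rotation_jac.
  + by rewrite /tr /trans /= psiK.
  + exact: cod_phi.
  + by rewrite psiK.
- by rewrite memNset.
Qed.

(** The fibre coordinate of the conformal section of [g]. *)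
Definition conformal_col k p : 'cV[R]_2 := col 0 (rotation (g k p)).

Lemma phi_conformal_section k x : dom k x ->
  phi (c := Zbundle M) k (conformal_section g x) = (phi k x, conformal_col k (phi k x)).
Proof. by move=> dk; rewrite /= mem_set. Qed.

Lemma cod_conformal_col k p : cod k p ->
  cod (X := Zbundle M) k (p, conformal_col k p).
Proof.
move=> kp; have dx := dom_psi kp; exists (conformal_section g (psi k p)).
  exact: dom_conformal_section.
by rewrite phi_conformal_section // phiK.
Qed.

Lemma conformal_col_gt0 k p : cod k p -> 0 < conformal_col k p 1 0.
Proof. by move=> /cod_conformal_col/cod_Zbundle[]. Qed.

(** These polynomial relations determine the metric from the area density and the
    fibre coordinate; differentiating them avoids the derivative formulas for
    square roots and inverse matrices. *)
Lemma area_formE k p : cod k p ->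
  [/\ 0 < area_form g k p,
      area_form g k p * area_form g k p = \det (g k p),
      area_form g k p * conformal_col k p 0 0 = - g k p 0 1 &
      area_form g k p * conformal_col k p 1 0 = g k p 0 0].
Proof.
move=> kp; have [_ d0] := metric_det_gt0 kp.
have s0 : 0 < area_form g k p by rewrite sqrtr_gt0.
have sN := lt0r_neq0 s0.
rewrite /conformal_col rotationE // -/(area_form g k p).
split=> //; first by rewrite -expr2 sqr_sqrtr ?ltW.
  by rewrite !mxE /= mulVKf.
by rewrite !mxE /= mulVKf.
Qed.

Lemma metric_differentiable k p : cod k p -> differentiable (g k) p.
Proof. exact: smooth_differentiable (@gmx_smooth R M g k). Qed.

Lemma det_smooth k : smooth (cod k) (fun p => \det (g k p) : R^o).
Proof.
move=> n; have ok := @open_cod R M k; have Cg i j := Ck_entry i j ok (@gmx_smooth R M g k n).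
apply: (@Ck_eq _ _ _ _ _ (fun p => g k p 0 0 * g k p 1 1
   + (-1) * (g k p 0 1 * g k p 1 0))) => // [p _|].
  by rewrite det2 mulN1r.
apply: CkD => //; first exact: CkM.
by apply: CkM => //; [exact: Ck_cst|exact: CkM].
Qed.

Lemma rotation_smooth k : smooth (cod k) (fun p => rotation (g k p)).
Proof.
move=> n; have ok := @open_cod R M k; have Cg i j := Ck_entry i j ok (@gmx_smooth R M g k n).
have Cs : Ck n (cod k) (fun p => (Num.sqrt (\det (g k p)))^-1 : R^o).
  by apply: smooth_rsqrt => // [|p /metric_det_gt0[]//]; exact: det_smooth.
have CN i j : Ck n (cod k) (fun p => -1 * g k p i j : R^o).
  by apply: CkM => //; exact: Ck_cst.
apply: (@Ck_eq _ _ _ _ _ (fun p => \matrix_(i, j) ((Num.sqrt (\det (g k p)))^-1 *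
  (if i == 0 then if j == 0 then -1 * g k p 0 1 else -1 * g k p 1 1
   else if j == 0 then g k p 0 0 else g k p 1 0)))) => // [p /metric_det_gt0[_ d0]|].
  by rewrite rotationE //; apply/matrixP => i j; rewrite !mxE !mulN1r.
apply: Ck_mx => // i j.
apply: (@Ck_eq _ _ _ _ _ (fun p => (Num.sqrt (\det (g k p)))^-1 *
  (if i == 0 then if j == 0 then -1 * g k p 0 1 else -1 * g k p 1 1
   else if j == 0 then g k p 0 0 else g k p 1 0) : R^o)) => // [p _|]; first by rewrite mxE.
by apply: CkM => //; case: (i == 0); case: (j == 0).
Qed.

Lemma conformal_col_differentiable k p : cod k p ->
  differentiable (conformal_col k) p.
Proof.
move=> kp; apply: differentiable_mx => i j.
rewrite [X in differentiable X _](_ : _ = (fun q => rotation (g k q) i 0 : R^o));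
  last by apply/funext => q; rewrite mxE.
exact/differentiable_entry/(smooth_differentiable (@rotation_smooth k)).
Qed.

Notation s := (conformal_section g).

Lemma cod_image_surface k : cod (X := image_surface s) k = cod (X := atlas M) k.
Proof.
apply/seteqP; split=> p /= [].
  by move=> _ [x dx <-] <-; exists x.
by move=> x dx <-; exists (s x) => //; exists x.
Qed.

Lemma overlap_image_surface k l p :
  overlap (X := image_surface s) k l p -> overlap (X := atlas M) k l p.
Proof.
move=> [_ [[x dk <-] [y dl [yx _]]] <-] /=.
by exists x => //; split=> //; rewrite -yx.
Qed.

Definition rotation_field k p w : 'cV[R]_2 := rotation (g k p) *m w.

Lemma rotation_field_linear k p :
  cod (X := image_surface s) k p -> linear (rotation_field k p).
Proof. by move=> _ r u v; rewrite /rotation_field mulmxDr scalemxAr. Qed.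

Lemma rotation_field_square k p v : cod (X := image_surface s) k p ->
  rotation_field k p (rotation_field k p v) = - v.
Proof.
rewrite cod_image_surface => /rotation_oriented[jj _].
by rewrite /rotation_field mulmxA jj mulNmx mul1mx.
Qed.

Lemma rotation_field_compat k l p v : overlap (X := image_surface s) k l p ->
  rotation_field l (trans (X := image_surface s) k l p)
    ('d (@trans R _ _ (image_surface s) k l) p v)
  = 'd (@trans R _ _ (image_surface s) k l) p (rotation_field k p v).
Proof.
move=> /overlap_image_surface/overlapP[kp dl].
rewrite -[LHS]/(rotation_field l (tr k l p) ('d (tr k l) p v)).
rewrite -[RHS]/('d (tr k l) p (rotation_field k p v)) /rotation_field -!mul_jac.
by rewrite [LHS]mulmxA -(rotation_jac kp dl) -mulmxA.
Qed.

Lemma rotation_field_smooth k v :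
  smooth (cod (X := image_surface s) k) (rotation_field k ^~ v).
Proof.
rewrite cod_image_surface => n; have ok := @open_cod R M k.
have Cr i j := Ck_entry i j ok (@rotation_smooth k n).
apply: Ck_mx => // i j.
apply: (@Ck_eq _ _ _ _ _ (fun p => rotation (g k p) i 0 * v 0 j +
   rotation (g k p) i 1 * v 1 j : R^o)) => // [p _|].
  by rewrite [RHS]mxE sum2.
by apply: CkD => //; apply: CkM => //; exact: Ck_cst.
Qed.

(** An adapted almost complex structure of Z covers the rotation of [g] along the
    section ([omega_rotate]), so the image can be a holomorphic curve for no
    other complex structure. *)
Definition rotation_structure : almost_complex (image_surface s) :=
  @AlmostComplex R _ _ (image_surface s) rotation_field (@rotation_field_linear)
    (@rotation_field_square) (@rotation_field_compat) (@rotation_field_smooth).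

(** The inclusion in Z of the image of the conformal section. *)
Definition section_rep k l :=
  local_rep (X := image_surface s) (Y := Zbundle M) id k l.

Lemma section_repE k l p : cod k p -> dom l (psi k p) ->
  section_rep k l p = (tr k l p, conformal_col l (tr k l p)).
Proof. by move=> kp dl; rewrite /section_rep /local_rep /= mem_set. Qed.

Lemma diff_section_rep k l p v : cod k p -> dom l (psi k p) ->
  let u := jac (tr k l) p *m v in
  'd (section_rep k l) p v = (u, 'D_u (conformal_col l) (tr k l p)).
Proof.
move=> kp dl u; have lq : cod l (tr k l p) by exact: cod_phi.
have dtr := tr_differentiable kp dl.
have dcol := conformal_col_differentiable lq.
have dcomp : differentiable (conformal_col l \o tr k l) p.
  exact: differentiable_comp.
pose f q := (tr k l q, (conformal_col l \o tr k l) q).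
have df : differentiable f p by exact: differentiable_pair.
have near_f : {near p, f =1 section_rep k l}.
  apply: filterS2 (near_cod kp) (near_dom_psi kp dl) => q kq dlq.
  by rewrite section_repE.
have [_ dE] := near_eq_diff near_f df.
rewrite (congr1 (@^~ v) dE) (congr1 (@^~ v) (diff_pair dtr dcomp)).
congr (_, _); first exact/esym/mul_jac.
transitivity ('d (conformal_col l) (tr k l p) ('d (tr k l) p v)).
  exact: (congr1 (@^~ v) (diff_comp dtr dcol)).
rewrite (deriveE _ dcol) /u; congr ('d _ _ _).
exact/esym/mul_jac.
Qed.

End ConformalSection.

(** * Holomorphic curves and the Levi-Civita connection *)

Section Main.
Context {R : realType} {M : oriented_surface (R := R)} (g : metric M).
Implicit Types (k l : idx (atlas M)) (p q w dc : 'cV[R]_2) (D : connection M).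

Notation fib := (conformal_col g).
Notation rot k p := (rotation (g k p)).
Notation frame k p := (p, frame_of_col (fib k p)).

(** A lift to F of the image of [w] under the differential of the section. *)
Definition curve_lift k p w := lift_vec w ('D_w (fib k) p).

(** The form [eta] pulls back along the section to a form of type (1,0) for the
    complex structure of [g]. *)
Definition form_holomorphic
    (eta : idx (atlas M) -> 'cV[R]_2 * 'M[R]_2 -> 'cV[R]_2 * 'M[R]_2 -> R[i]) :=
  forall k p w, cod k p ->
    eta k (frame k p) (curve_lift k p (rot k p *m w)) =
    imag * eta k (frame k p) (curve_lift k p w).

(** The image carries the complex structure of [g]; both generators [omega] and
    [eta] multiply by [i] along the section, so J extends it. *)
Lemma form_holomorphic_curve eta J : adapted eta J -> form_holomorphic eta ->
  holomorphic_curve J (conformal_section g).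
Proof.
move=> adJ hol; exists (rotation_structure g) => k l p.
rewrite cod_image_surface => kp [/= dl _] v.
have lq : cod l (tr k l p) by exact: cod_phi.
suff: J l (section_rep g k l p) ('d (section_rep g k l) p v) =
  'd (section_rep g k l) p (rotation_field g k p v) by [].
rewrite (section_repE g kp dl) (diff_section_rep g v kp dl).
rewrite (diff_section_rep g (rotation_field g k p v) kp dl).
rewrite /rotation_field mulmxA (rotation_jac g kp dl) -mulmxA.
apply: (adapted_acs adJ); [exact: cod_conformal_col| |exact: hol].
by apply: omega_rotate; exact: rotation_oriented.
Qed.

(** Choose a vector of Z over the rotated [w] on which [eta] takes the value
    required by type (1,0).  By [adapted_acs] it is the image under J of the
    tangent vector of the curve, hence tangent to the curve, hence the tangent
    vector over the rotated [w]. *)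
Lemma holomorphic_curve_form eta J : adapted eta J ->
  (forall k p w z, cod k p ->
     exists dc, eta k (frame k p) (lift_vec w dc) = z) ->
  holomorphic_curve J (conformal_section g) -> form_holomorphic eta.
Proof.
move=> adJ surj [j hol] k p w kp; have dk := dom_psi kp.
have [dc etaE] := surj k p (rot k p *m w) (imag * eta k (frame k p) (curve_lift k p w)) kp.
have jac1 : jac (tr k k) p = 1%:M.
  by rewrite -[p in LHS](phiK kp); exact: jac_at_id.
have trp : tr k k p = p by exact: phiK.
have ikp : cod (X := image_surface (conformal_section g)) k p by rewrite cod_image_surface.
(* Reading the condition in a single chart suffices: there the inclusion is
   [p |-> (p, fib k p)]. *)
have Jcurve : J k (section_rep g k k p) ('d (section_rep g k k) p w) =
    'd (section_rep g k k) p (j k p w).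
  exact: (hol k k p ikp (dom_conformal_section g dk) w).
have diffE v : 'd (section_rep g k k) p v = (v, 'D_v (fib k) p).
  by rewrite (diff_section_rep g v kp dk) jac1 mul1mx trp.
have omegaE := omega_rotate p w ('D_w (fib k) p) dc (rotation_oriented g kp).
move: Jcurve; rewrite (section_repE g kp dk) trp !diffE.
rewrite (adapted_acs adJ (cod_conformal_col g kp) omegaE etaE) => -[<- dcE].
by rewrite -etaE /curve_lift dcE.
Qed.

(** The hypotheses of [parallel_metric]: the Leibniz rule applied to
    [area_formE]. *)
Lemma area_form_derive k p w : cod k p ->
  let ds := 'D_w (area_form g k : 'cV[R]_2 -> R^o) p in
  let dc := 'D_w (fib k) p in let dg := 'D_w (g k) p in
  let s := area_form g k p in
  [/\ dg^T = dg,
      ds * s + s * ds = dg 0 0 * g k p 1 1 + g k p 0 0 * dg 1 1 - 2 * g k p 0 1 * dg 0 1,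
      ds * fib k p 0 0 + s * dc 0 0 = - dg 0 1 &
      ds * fib k p 1 0 + s * dc 1 0 = dg 0 0].
Proof.
move=> kp ds dc dg s.
have dgd := metric_differentiable g kp.
have dcd := conformal_col_differentiable g kp.
have dgE i j : dg i j = 'D_w (fun q => g k q i j : R^o) p by exact: derive_entry.
have dcE i : dc i 0 = 'D_w (fun q => fib k q i 0 : R^o) p by exact: derive_entry.
have dgij i j : derivable (fun q => g k q i j : R^o) p w.
  exact/diff_derivable/differentiable_entry.
have dcij i : derivable (fun q => fib k q i 0 : R^o) p w.
  exact/diff_derivable/differentiable_entry.
have dsd : derivable (area_form g k : _ -> R^o) p w.
  apply: diff_derivable; apply: differentiable_sqrt; last by have [] := metric_det_gt0 g kp.
  exact: smooth_differentiable (@det_smooth R M g k) kp.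
have prod (a b : 'cV[R]_2 -> R^o) : derivable a p w -> derivable b p w ->
    'D_w (fun q => a q * b q : R^o) p = 'D_w a p * b p + a p * 'D_w b p.
  move=> da db; rewrite [LHS](deriveM da db) /GRing.scale /=; ring.
have eqD (a b : 'cV[R]_2 -> R^o) : (forall q, cod k q -> a q = b q) ->
    'D_w a p = 'D_w b p.
  move=> ab; apply: near_eq_derive; exact: near_open (@open_cod R M k) kp ab.
split.
- apply/matrixP => i j; rewrite mxE !dgE; apply: eqD => q kq.
  by rewrite -[in LHS](gmx_sym g kq) mxE.
- rewrite -[LHS](prod _ _ dsd dsd) !dgE.
  rewrite (eqD _ (fun q => g k q 0 0 * g k q 1 1 - g k q 0 1 * g k q 0 1)).
    rewrite (deriveB (derivableM (dgij 0 0) (dgij 1 1)) (derivableM (dgij 0 1) (dgij 0 1))).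
    rewrite (prod _ _ (dgij 0 0) (dgij 1 1)) (prod _ _ (dgij 0 1) (dgij 0 1)).
    ring.
  move=> q kq; have [_ -> _ _] := area_formE g kq; rewrite det2.
  by congr (_ - _ * _); rewrite -[in LHS](gmx_sym g kq) mxE.
- rewrite dcE dgE -[LHS](prod _ _ dsd (dcij 0)) -deriveN //; apply: eqD => q kq.
  by have [_ _ -> _] := area_formE g kq.
- rewrite dcE dgE -[LHS](prod _ _ dsd (dcij 1)); apply: eqD => q kq.
  by have [_ _ _ ->] := area_formE g kq.
Qed.

Lemma parallel_metricP D k p w : cod k p ->
  'D_w (g k) p = (D k p w)^T *m g k p + g k p *m D k p w <->
  'D_w (area_form g k : 'cV[R]_2 -> R^o) p = \tr (D k p w) * area_form g k p /\
  zeta D k (frame k p) (curve_lift k p w) = 0.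
Proof.
move=> kp; have [s0 sE s01 s00] := area_formE g kp.
have [dgT dsE d01 d00] := area_form_derive w kp.
have := parallel_metric (D k p w) s0 (conformal_col_gt0 g kp) (gmx_sym g kp)
  dgT sE s01 s00 dsE d01 d00.
rewrite /zeta /connection_form /= => ->.
by split=> [[-> -> ->]|[-> [-> ->]]].
Qed.

(** A torsion-free connection preserves [g] when it preserves separately the
    area form and the conformal class, the latter being the vanishing of [zeta]
    on lifts of the conformal section. *)
Lemma levi_civitaP D : levi_civita g D <->
  [/\ torsion_free D, preserves D (area_form g) &
      forall k p w, cod k p -> zeta D k (frame k p) (curve_lift k p w) = 0].
Proof.
split=> [[tD gD]|[tD sD zD]].
  by split=> // [k p w kp|k p w kp]; have [] := (parallel_metricP D w kp).1 (gD k p w kp).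
split=> // k p w kp; apply/parallel_metricP => //; split; [exact: sD|exact: zD].
Qed.

End Main.

Theorem theorem1p1 (R : realType) (M : oriented_surface (R := R))
    (P : projective_structure M) (g : metric M)
    (J : almost_complex (Zbundle M)) (hJ : is_Jproj P J)
    (JJ : almost_complex (Zbundle M)) (hJJ : is_Jvol P (area_form g) JJ) :
  metrisable_by P g <->
  holomorphic_curve J (conformal_section g) /\
  holomorphic_curve JJ (conformal_section g).
Proof.
have [Ds [PDs sDs uniqDs] adJJ] := hJJ.
split=> [[D PD LCD]|[hol ahol]].
  have [_ sD zD] := (levi_civitaP g D).1 LCD.
  (* Both sides of the type (1,0) condition vanish. *)
  have imag0 (z z' : R[i]) : z' = 0 -> z = 0 -> z' = imag * z.
    by move=> -> ->; rewrite mulr0.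
  have DE := uniqDs D PD sD.
  have zDs k p w : cod k p ->
      zeta Ds k (p, frame_of_col (conformal_col g k p)) (curve_lift g k p w) = 0.
    by move=> kp; rewrite -(zD k p w kp) /zeta /connection_form /= DE.
  split.
    apply: (form_holomorphic_curve (hJ _ PD)) => k p w kp.
    by apply: imag0; exact: zD.
  apply: (form_holomorphic_curve adJJ) => k p w kp.
  by apply: imag0; apply/eqP; rewrite conjc_eq0; apply/eqP; exact: zDs.
(* The connection of [P] preserving the area form defines both structures, so
   both conditions apply to the same [zeta]. *)
exists Ds => //; apply/levi_civitaP; split=> //.
  by have [D0 _ PE] := pconnP P; move: PDs; rewrite PE => -[].
have surj k p w z : cod k p -> exists dc,
    zeta Ds k (p, frame_of_col (conformal_col g k p)) (lift_vec w dc) = z.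
  by move=> kp; apply: zeta_lift_surj; exact: conformal_col_gt0.
have csurj k p w z : cod k p -> exists dc,
    ((zeta Ds k (p, frame_of_col (conformal_col g k p)) (lift_vec w dc))^*)%C = z.
  by move=> /(surj k p w (z^*)%C)[dc e]; exists dc; rewrite e conjcK.
move=> k p w kp.
exact: eq0_of_imag_conj (holomorphic_curve_form (hJ _ PDs) surj hol w kp)
  (holomorphic_curve_form adJJ csurj ahol w kp).
Qed.
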